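(* Let $x_1,\ldots,x_m$ be distinct points in the open left half plane $\{\operatorname{Re}(s)<0\}$ and $y_1,\ldots,y_m\in\mathbb{C}\setminus\{0\}$, with the data closed under complex conjugation. Let $\eta(s)=\prod_{j=1}^m(s-x_j)$, $\phi_j(s)=\prod_{k\ne j}(s-x_k)$, let $\gamma_1,\ldots,\gamma_m$ and $c_1,\ldots,c_m$ be non-zero conjugation-compatible coefficients, and put $$d_o=\sum_{j=1}^m\gamma_j\phi_j,\quad d_1=\eta+\sum_{j=1}^m c_j\phi_j,\quad \hat\nu_o=\sum_{j=1}^m \frac{\gamma_j}{y_j}\phi_j,\quad \hat\nu_1=\sum_{j=1}^m \frac{c_j}{y_j}\phi_j,$$ $$\hat p_k=\frac{\hat\nu_k}{d_k},\qquad \Delta_k=\frac{\eta}{d_k},\qquad \hat f_k=\big(\hat p_k+\hat r_k\Delta_k\big)^{-1}\quad(\hat r_k\in\mathbb{R}),\qquad k\in\{o,1\}.$$ Assume that $\Delta_o$ and $\Delta_1$ are strictly positive real. For $k\in\{o,1\}$ let $\underline{\hat r}_k$ denote the smallest $\hat r\in\mathbb{R}$ such that $\operatorname{Re}\big((\hat p_k(s)+\hat r\Delta_k(s))^{-1}\big)\ge 0$ for all $s$ with $\operatorname{Re}(s)>0$. Then $$\underline{\hat r}_k=-\inf_{\operatorname{Re}(s)>0}\frac{\operatorname{Re}\,\hat p_k(s)}{\operatorname{Re}\,\Delta_k(s)},\qquad k\in\{o,1\},$$ and $\hat f_k$ is positive real if and only if $\hat r_k\ge\underline{\hat r}_k$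.
   Context: Data closed under complex conjugation: the indices are ordered so that $\operatorname{Im}(x_j)>0$ implies $x_{j+1}=\overline{x_j}$ and $y_{j+1}=\overline{y_j}$, every non-real node belongs to such a pair, and $y_j\in\mathbb{R}$ if $x_j\in\mathbb{R}$. Coefficients $c_1,\ldots,c_m\in\mathbb{C}$ are conjugation-compatible if $c_j\in\mathbb{R}$ when $x_j\in\mathbb{R}$ and $c_{j+1}=\overline{c_j}$ when $\operatorname{Im}(x_j)>0$. A rational function $f$ with real coefficients is positive real if $\operatorname{Re}(f(s))\ge 0$ for all $s$ with $\operatorname{Re}(s)>0$ (so it is analytic there); it is strictly positive real if $f(s-\epsilon)$ is positive real for some $\epsilon>0$. *)

(* Defs.v *)
From HB Require Import structures.
From mathcomp Require Import all_boot all_order all_algebra.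
From mathcomp Require Import complex.
From mathcomp Require Import all_classical all_reals ereal.

Set Implicit Arguments.
Unset Strict Implicit.
Unset Printing Implicit Defensive.

Import Order.TTheory GRing.Theory Num.Theory.

Local Open Scope classical_set_scope.
Local Open Scope complex_scope.
Local Open Scope ring_scope.

Notation "p %:F" := (@FracField.tofrac _ p) : ring_scope.

Lemma fracE (T : idomainType) (f : {fraction T}) :
  f * (\d_(repr f))%:F = (\n_(repr f))%:F.
Proof.
have d0 := denom_ratioP (repr f).
rewrite -{1}[f]reprK; unlock FracField.tofrac; rewrite -[LHS]FracField.pi_mul.
apply/eqmodP => /=; rewrite FracField.equivfE /FracField.mulf /=.
by rewrite !numden_Ratio ?mulr1 ?mulf_neq0 ?oner_neq0 // mulrC.
Qed.

(* Rational functions over C are elements of the field {fraction {poly R[i]}};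
   they are evaluated through a numerator and a denominator without common
   factor, so that removable singularities are removed. *)
Section RationalFunctions.
Variable R : realType.
Local Notation C := R[i].
Local Notation ratfun := {fraction {poly C}}.

Definition rat_num (f : ratfun) : {poly C} :=
  \n_(repr f) %/ gcdp \n_(repr f) \d_(repr f).

Definition rat_den (f : ratfun) : {poly C} :=
  \d_(repr f) %/ gcdp \n_(repr f) \d_(repr f).

Definition rat_analytic_at (f : ratfun) (s : C) : Prop := (rat_den f).[s] != 0.

(* Meaningful only where [f] is analytic. *)
Definition rat_eval (f : ratfun) (s : C) : C := (rat_num f).[s] / (rat_den f).[s].

(* The rational function s |-> f (s - e). *)
Definition rat_shift (f : ratfun) (e : R) : ratfun :=
  (rat_num f \Po ('X - (e%:C)%:P))%:F / (rat_den f \Po ('X - (e%:C)%:P))%:F.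

Definition rat_real_coefs (f : ratfun) : Prop :=
  exists p q : {poly R}, q != 0 /\
    f = (map_poly (real_complex R) p)%:F / (map_poly (real_complex R) q)%:F.

(* The open right half plane. *)
Definition rhp : set C := [set s | 0 < complex.Re s].

(* "Re (f s) >= 0 for all s with Re s > 0"; in particular f has no pole there. *)
Definition rhp_nonneg_Re (f : ratfun) : Prop :=
  forall s, rhp s -> rat_analytic_at f s /\ 0 <= complex.Re (rat_eval f s).

Definition positive_real (f : ratfun) : Prop :=
  rat_real_coefs f /\ rhp_nonneg_Re f.

Definition strictly_positive_real (f : ratfun) : Prop :=
  exists2 e : R, 0 < e & positive_real (rat_shift f e).

Lemma rat_num_den (f : ratfun) :
  [/\ rat_den f != 0, coprimep (rat_num f) (rat_den f)
    & f = (rat_num f)%:F / (rat_den f)%:F].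
Proof.
have d0 := denom_ratioP (repr f).
have g0 : gcdp \n_(repr f) \d_(repr f) != 0 by rewrite gcdp_eq0 negb_and d0 orbT.
have dE : \d_(repr f) = rat_den f * gcdp \n_(repr f) \d_(repr f).
  by rewrite /rat_den divpK ?dvdp_gcdr.
have nE : \n_(repr f) = rat_num f * gcdp \n_(repr f) \d_(repr f).
  by rewrite /rat_num divpK ?dvdp_gcdl.
have rd0 : rat_den f != 0.
  by apply: contra_neq d0 => r0; rewrite dE r0 mul0r.
split=> //; first by rewrite /rat_num /rat_den coprimep_div_gcd // d0 orbT.
apply: (canRL (mulfK _)); first by rewrite tofrac_eq0.
have gF0 : (gcdp \n_(repr f) \d_(repr f))%:F != 0 :> ratfun by rewrite tofrac_eq0.
by apply: (mulIf gF0); rewrite -mulrA -!tofracM -dE -nE fracE.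
Qed.

Lemma rat_fracE (p q : {poly C}) (s : C) (f := p%:F / q%:F : ratfun) :
  q.[s] != 0 -> rat_analytic_at f s /\ rat_eval f s = p.[s] / q.[s].
Proof.
move=> qs; have [d0 cop fE] := rat_num_den f.
have q0 : q != 0 by apply: contra_neq qs => ->; rewrite horner0.
have E : p * rat_den f = rat_num f * q.
  apply/eqP; rewrite -tofrac_eq !tofracM -eqr_div ?tofrac_eq0 //.
  by apply/eqP; rewrite -/f.
have Es : p.[s] * (rat_den f).[s] = (rat_num f).[s] * q.[s] by rewrite -!hornerM E.
have ds : (rat_den f).[s] != 0.
  apply/negP => /eqP z; move: Es; rewrite z mulr0 => /esym/eqP.
  rewrite mulf_eq0 (negPf qs) orbF => /eqP nz.
  have [[u v] /= uv] := Bezout_eq1_coprimepP _ _ cop.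
  have := congr1 (fun P : {poly C} => P.[s]) uv.
  rewrite !hornerE nz z !mulr0 addr0 => /eqP.
  by rewrite eq_sym oner_eq0.
split=> //; apply/esym/eqP; rewrite /rat_eval eqr_div //; exact/eqP.
Qed.

Lemma rat_shiftE (f : ratfun) (e : R) (s : C) :
  rat_analytic_at f (s - e%:C) ->
  rat_analytic_at (rat_shift f e) s /\
  rat_eval (rat_shift f e) s = rat_eval f (s - e%:C).
Proof.
rewrite /rat_shift /rat_analytic_at => h.
have [|a ->] := @rat_fracE (rat_num f \Po ('X - (e%:C)%:P))
  (rat_den f \Po ('X - (e%:C)%:P)) s; first by rewrite horner_comp !hornerE.
by split=> //; rewrite /rat_eval !horner_comp !hornerE.
Qed.

End RationalFunctions.

Section Data.
Variables (R : realType) (m : nat).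
Local Notation C := R[i].
Local Notation ratfun := {fraction {poly C}}.
Implicit Types x y c gamma : 'I_m -> C.

Definition conj_closed x y : Prop :=
  [/\ forall j, 0 < complex.Im (x j) ->
        exists2 j' : 'I_m, j' = j.+1 :> nat & x j' = (x j)^* /\ y j' = (y j)^*,
      forall j, complex.Im (x j) != 0 ->
        exists2 i : 'I_m, 0 < complex.Im (x i) & j = i \/ j = i.+1 :> nat
    & forall j, complex.Im (x j) = 0 -> complex.Im (y j) = 0].

Definition conj_compatible x c : Prop :=
  (forall j, complex.Im (x j) = 0 -> complex.Im (c j) = 0) /\
  (forall j j' : 'I_m, 0 < complex.Im (x j) -> j' = j.+1 :> nat -> c j' = (c j)^*).

Definition eta x : {poly C} := \prod_(j < m) ('X - (x j)%:P).

Definition phi x (j : 'I_m) : {poly C} := \prod_(k < m | k != j) ('X - (x k)%:P).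

(* The index k ranges over {o, 1}. *)
Inductive kind := kind_o | kind_1.

Definition d_poly x gamma c (k : kind) : {poly C} :=
  match k with
  | kind_o => \sum_(j < m) gamma j *: phi x j
  | kind_1 => eta x + \sum_(j < m) c j *: phi x j
  end.

Definition nu_hat x y gamma c (k : kind) : {poly C} :=
  match k with
  | kind_o => \sum_(j < m) (gamma j / y j) *: phi x j
  | kind_1 => \sum_(j < m) (c j / y j) *: phi x j
  end.

Definition p_hat x y gamma c (k : kind) : ratfun :=
  (nu_hat x y gamma c k)%:F / (d_poly x gamma c k)%:F.

Definition Delta x gamma c (k : kind) : ratfun :=
  (eta x)%:F / (d_poly x gamma c k)%:F.

(* The inverse is taken in the field of rational functions. *)
Definition f_hat x y gamma c (k : kind) (r : R) : ratfun :=
  (p_hat x y gamma c k + ((r%:C)%:P)%:F * Delta x gamma c k)^-1.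

End Data.

(* Main.v *)
(* Write D = eta / d_k and p = nu_k / d_k. The point is that Re p / Re D is bounded below
   on Re s > 0. Since Re D >= 0 on Re s > -e, for Re w < 0 the polynomial eta - w d_k has
   no root in that half plane, and the factorization of such a polynomial P gives
     |lead P| (Re s + e)^deg P <= |P(s)|  and  (Re s + e) |P'(s)| <= deg P |P(s)|.
   The first estimate, as w tends to i Im D(s), gives (Re s + e)^m <= |d_k(s)| Re D(s), which
   settles bounded s. For large s and k = 1, D tends to 1; for k = o, the second estimate
   with w = - conj D(s) gives |eta' d_o - eta d_o'| <= const |d_o|^2 Re D, and eta' d_o - eta d_o'
   has degree at least that of nu_o d_o.
   Comparing |P(s)| with |P(t)| by the same factorization for P = n + delta d, delta -> 0,
   shows that a rational function with nonnegative real part has no zero in the half plane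
   unless it vanishes identically, so passing to the inverse does not create poles. *)
Require Import Defs.
From HB Require Import structures.
From mathcomp Require Import all_boot all_order all_algebra.
From mathcomp Require Import complex.
From mathcomp Require Import all_classical all_reals ereal.
From mathcomp Require Import ring lra.

Set Implicit Arguments.
Unset Strict Implicit.
Unset Printing Implicit Defensive.

Import Order.TTheory GRing.Theory Num.Theory.

Local Open Scope classical_set_scope.
Local Open Scope complex_scope.
Local Open Scope ring_scope.

(** * Polynomials without zeros in a half plane, and growth at infinity *)

Section HalfPlane.
Variable R : realType.
Local Notation C := R[i].
Local Notation Re := complex.Re.
Implicit Types (P : {poly C}) (s z : C) (a : R).

Lemma Re_le_norm z : (Re z)%:C <= `|z|.
Proof. by apply: le_trans (normc_ge_Re z); rewrite lecR ler_norm. Qed.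

Lemma ReD z1 z2 : Re (z1 + z2) = Re z1 + Re z2.
Proof. by case: z1 z2 => ? ? [? ?]. Qed.

Lemma ReN z : Re (- z) = - Re z.
Proof. by case: z. Qed.

Lemma ReB z1 z2 : Re (z1 - z2) = Re z1 - Re z2.
Proof. by rewrite ReD ReN. Qed.

Lemma Re_scale a z : Re (a%:C * z) = a * Re z.
Proof. by case: z => ? ? /=; rewrite mul0r subr0. Qed.

Lemma halfplane_factor a P : (forall s, a < Re s -> P.[s] != 0) ->
  exists2 rs : seq C, P = lead_coef P *: \prod_(r <- rs) ('X - r%:P) &
    size P = (size rs).+1 /\ all (fun r => Re r <= a) rs.
Proof.
move=> hP; have [rs E] := closed_field_poly_normal P; exists rs => //.
have P0 : lead_coef P != 0.
  have : P.[(a + 1)%:C] != 0 by apply: hP; rewrite /= ltrDl.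
  by rewrite lead_coef_eq0; apply: contraNneq => ->; rewrite horner0.
split; first by rewrite E size_scale // size_prod_XsubC.
apply/allP=> r rin; rewrite leNgt; apply: contraL rin => /hP; apply: contra => rin.
by rewrite E hornerZ mulf_eq0 -[_.[_] == 0]/(root _ _) root_prod_XsubC rin orbT.
Qed.

Lemma dist_halfplane a s r : Re r <= a -> (Re s - a)%:C <= `|s - r|.
Proof.
by move=> h; apply: le_trans (Re_le_norm _); rewrite lecR ReB lerB.
Qed.

Lemma halfplane_lead_le a P s : (forall s, a < Re s -> P.[s] != 0) -> a < Re s ->
  `|lead_coef P| * (Re s - a)%:C ^+ (size P).-1 <= `|P.[s]|.
Proof.
move=> /halfplane_factor[rs E [szP hrs]] as_.
have b0 : 0 <= (Re s - a)%:C :> C by rewrite ler0c subr_ge0 ltW.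
rewrite szP {2}E hornerZ normrM ler_wpM2l //=.
elim: rs hrs {E szP} => [|r rs IH] /=; first by rewrite big_nil hornerC normr1.
case/andP=> hr /IH {}IH.
rewrite big_cons hornerM hornerXsubC normrM exprS ler_pM ?exprn_ge0 //.
exact: dist_halfplane.
Qed.

(** The logarithmic derivative is the sum of [1 / (s - r)] over the roots, each term of norm at most
    [1 / (Re s - a)]; the induction is the product rule with denominators cleared. *)
Lemma halfplane_deriv_le a P s : (forall s, a < Re s -> P.[s] != 0) -> a < Re s ->
  (Re s - a)%:C * `|P^`().[s]| <= (size P).-1%:R * `|P.[s]|.
Proof.
move=> /halfplane_factor[rs E [szP hrs]] as_.
have b0 : 0 <= (Re s - a)%:C :> C by rewrite ler0c subr_ge0 ltW.
rewrite szP E derivZ !hornerZ !normrM mulrCA [leRHS]mulrCA ler_wpM2l //=.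
elim: rs hrs {E szP} => [|r rs IH] /=.
  by rewrite big_nil derivC horner0 normr0 mulr0 mul0r.
case/andP=> /(dist_halfplane s) hr /IH {}IH.
rewrite big_cons derivM derivXsubC mul1r hornerD !hornerM hornerXsubC normrM.
set A := _.[s] in IH *; set B := _.[s] in IH *.
apply: le_trans (ler_wpM2l b0 (ler_normD _ _)) _.
rewrite mulrDr normrM -addn1 natrD mulrDl mul1r addrC.
apply: lerD; last by rewrite ler_wpM2r.
by rewrite mulrCA [leRHS]mulrCA ler_wpM2l.
Qed.

(** Root by root, [|t - r| <= |t - s| + |s - r|] and [Re s - a <= |s - r|] compare the factors at
    [t] and [s]. Any [N] bounding the degree is allowed, so one constant serves a whole family of
    polynomials. *)
Lemma halfplane_harnack a P s t N : (forall s, a < Re s -> P.[s] != 0) -> a < Re s ->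
  (size P <= N.+1)%N ->
  (Re s - a)%:C ^+ N * `|P.[t]| <= ((Re s - a)%:C + `|t - s|) ^+ N * `|P.[s]|.
Proof.
move=> /halfplane_factor[rs E [szP hrs]] as_.
have b0 : 0 <= (Re s - a)%:C :> C by rewrite ler0c subr_ge0 ltW.
have bK : (Re s - a)%:C <= (Re s - a)%:C + `|t - s| by rewrite lerDl.
rewrite szP ltnS => leN.
rewrite E !hornerZ !normrM mulrCA [leRHS]mulrCA ler_wpM2l //=.
elim: rs N leN hrs {E szP} => [|r rs IH] N leN /=.
  by rewrite big_nil !hornerC normr1 !mulr1 lerXn2r ?nnegrE // (le_trans b0).
case/andP=> /(dist_halfplane s) hr; case: N leN => [//|N leN] /(IH N leN) {}IH.
rewrite !big_cons !hornerM !hornerXsubC !normrM !exprS mulrACA [leRHS]mulrACA.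
apply: ler_pM => //; rewrite ?mulr_ge0 ?exprn_ge0 //.
apply: le_trans (_ : (Re s - a)%:C * (`|t - s| + `|s - r|) <= _).
  by rewrite ler_wpM2l // (le_trans _ (ler_normD _ _)) // addrA subrK.
by rewrite mulrDr mulrDl addrC lerD2l mulrC ler_wpM2l.
Qed.

Lemma normC_eq0_small (z : C) (B : R) :
  (forall e : R, 0 < e -> `|z| <= (e * B)%:C) -> z = 0.
Proof.
move=> h; apply/eqP; rewrite -normr_eq0 eq_le normr_ge0 andbT.
rewrite -(RRe_real (normr_real z)) in h *; rewrite lecR.
apply/ler_addgt0Pl => e e0; rewrite addr0.
have B1 : 0 < 1 + `|B| by rewrite ltr_pwDl.
have := h (e / (1 + `|B|)) (divr_gt0 e0 B1).
rewrite lecR => /le_trans; apply.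
rewrite -mulrA ger_pMr // mulrC ler_pdivrMr // mul1r.
by rewrite (le_trans (ler_norm _)) // lerDr.
Qed.

Lemma posreal_zero_eq0 a (n d : {poly C}) s t :
    (forall s, a < Re s -> d.[s] != 0) ->
    (forall s, a < Re s -> 0 <= Re (n.[s] / d.[s])) ->
  a < Re s -> n.[s] = 0 -> n.[t] = 0.
Proof.
move=> dN0 hRe as_ ns.
pose N := maxn (size n) (size d).
have b0 : 0 < (Re s - a)%:C :> C by rewrite ltcR subr_gt0.
pose K : C := ((Re s - a)%:C + `|t - s|) ^+ N / (Re s - a)%:C ^+ N.
(* The error per unit of [e]: [|d.[t]|] from perturbing [n] at [t], and [K * |d.[s]|] from the
   Harnack bound at [s], where only [e * d] remains. *)
pose B : C := `|d.[t]| + K * `|d.[s]|.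
have K0 : 0 <= K by rewrite divr_ge0 ?exprn_ge0 ?addr_ge0 // ltW.
have B0 : 0 <= B by apply: addr_ge0 => //; apply: mulr_ge0.
have BE : B = (Re B)%:C by rewrite RRe_real // ger0_real.
apply: (@normC_eq0_small _ (Re B)) => e e0.
have hP z : a < Re z -> (n + e%:C *: d).[z] != 0.
  move=> az; apply/negP; rewrite hornerD hornerZ addr_eq0 => /eqP nz.
  have := hRe z az; rewrite nz mulNr mulfK ?dN0 //=.
  by rewrite oppr_ge0 leNgt e0.
have sz : (size (n + e%:C *: d)%R <= N.+1)%N.
  rewrite (leq_trans (size_polyD _ _)) // geq_max !leqW ?leq_maxl //.
  by rewrite (leq_trans (size_scale_leq _ _)) // leq_maxr.
have e0c : `|e%:C| = e%:C :> C by rewrite ger0_norm // ler0c ltW.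
have := halfplane_harnack t hP as_ sz.
rewrite mulrC -ler_pdivlMr ?exprn_gt0 // mulrAC -/K.
rewrite [in leRHS]hornerD [in leRHS]hornerZ ns add0r normrM e0c => h.
rewrite rmorphM /= -BE mulrDr mulrCA.
have -> : n.[t] = (n + e%:C *: d).[t] - e%:C * d.[t].
  by rewrite hornerD hornerZ addrK.
by rewrite (le_trans (ler_normB _ _)) // normrM e0c addrC lerD2l.
Qed.

Lemma horner_norm_le P s (M : C) N : `|s| <= M -> 1 <= M -> (size P <= N.+1)%N ->
  `|P.[s]| <= (\sum_(i < size P) `|P`_i|) * M ^+ N.
Proof.
move=> sM M1 szP; rewrite horner_coef (le_trans (ler_norm_sum _ _ _)) //.
rewrite mulr_suml ler_sum // => i _; rewrite normrM normrX ler_wpM2l //.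
rewrite (@le_trans _ _ (M ^+ i)) ?lerXn2r ?nnegrE //; first exact: le_trans sM.
by rewrite ler_weXn2l // -ltnS (leq_trans _ szP).
Qed.

(** Beyond twice the sum of the norms of the roots, each root has [|r| <= |s| / 2], hence
    [|s - r| >= |s| / 2]. *)
Lemma horner_norm_ge P : exists2 M : R, 0 <= M &
  forall s, M%:C <= `|s| -> `|lead_coef P| * (`|s| / 2) ^+ (size P).-1 <= `|P.[s]|.
Proof.
have [rs E] := closed_field_poly_normal P.
have [->|P0] := eqVneq P 0.
  by exists 0 => // s _; rewrite lead_coef0 normr0 mul0r.
have szP : size P = (size rs).+1.
  by rewrite E size_scale ?lead_coef_eq0 // size_prod_XsubC.
pose M := 2 * \sum_(r <- rs) Re `|r|.
have Re_ge0 (r : C) : 0 <= Re `|r|.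
  by rewrite -ler0c RRe_real ?normr_real.
exists M => [|s]; first by rewrite mulr_ge0 // sumr_ge0.
rewrite szP {2}E hornerZ normrM => Ms; rewrite ler_wpM2l //= {E P0 szP}.
elim: rs @M Ms => [|r rs IH] M Ms; first by rewrite big_nil hornerC normr1.
rewrite big_cons hornerM hornerXsubC normrM exprS ler_pM ?exprn_ge0 ?divr_ge0 //.
  have hr : `|r| <= `|s| / 2.
    rewrite ler_pdivlMr // mulrC -[`|r|]RRe_real ?normr_real //.
    rewrite -(rmorph_nat (real_complex R)) -rmorphM /= (le_trans _ Ms) // lecR.
    by rewrite ler_wpM2l // big_cons lerDl sumr_ge0.
  rewrite (le_trans _ (lerB_dist _ _)) // lerBrDr.
  by rewrite (le_trans (lerD (lexx _) hr)) // -splitr.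
apply: IH; rewrite (le_trans _ Ms) // lecR ler_wpM2l // big_cons lerDr //.
Qed.

Lemma horner_dominated (A B : {poly C}) : A != 0 -> (size B <= size A)%N ->
  exists M c : R, 0 <= c /\ forall s, M%:C <= `|s| -> `|B.[s]| <= c%:C * `|A.[s]|.
Proof.
move=> A0 szBA; have [M M0 hM] := horner_norm_ge A.
pose k := (size A).-1.
have lA : 0 < `|lead_coef A| :> C by rewrite normr_gt0 lead_coef_eq0.
pose c : C := (\sum_(i < size B) `|B`_i|) * 2 ^+ k / `|lead_coef A|.
have c0 : 0 <= c by rewrite divr_ge0 // mulr_ge0 // ?exprn_ge0 // sumr_ge0.
have cE : (Re c)%:C = c by rewrite RRe_real // ger0_real.
exists (1 + M), (Re c); rewrite -ler0c cE; split=> //.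
move=> s Ms.
have s1 : 1 <= `|s| by rewrite (le_trans _ Ms) // -[1]/(1%:C) lecR lerDl.
have szA : size A = k.+1 by rewrite prednK // lt0n size_poly_eq0.
have hB : `|B.[s]| <= (\sum_(i < size B) `|B`_i|) * `|s| ^+ k.
  by apply: horner_norm_le => //; rewrite -szA.
have hA : `|lead_coef A| * (`|s| / 2) ^+ k <= `|A.[s]|.
  by apply: hM; rewrite (le_trans _ Ms) // lecR lerDr.
apply: (le_trans hB); apply: le_trans (ler_wpM2l c0 hA).
rewrite /c -(mulrA _ _^-1) (mulrA _^-1) mulVf ?gt_eqF // mul1r.
by rewrite -(mulrA _ (2^+k)) ler_wpM2l ?sumr_ge0 // -exprMn mulrC divfK // pnatr_eq0.
Qed.

End HalfPlane.

(** * Degree of the Wronskian of two polynomials *)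

Lemma coefM_top (T : nzRingType) (p q : {poly T}) a b :
  (size p <= a.+1)%N -> (size q <= b.+1)%N -> (p * q)`_(a + b) = p`_a * q`_b.
Proof.
move=> sp sq; rewrite coefM.
have ha : (a < (a + b).+1)%N by rewrite ltnS leq_addr.
rewrite (bigD1 (Ordinal ha)) //= addKn big1 ?addr0 // => i.
rewrite -val_eqE neq_ltn /= => /orP[lt|lt].
  rewrite (nth_default _ (leq_trans sq _)) ?mulr0 //.
  by rewrite ltn_subRL ltn_add2r.
by rewrite nth_default ?mul0r // (leq_trans sp).
Qed.

Lemma coef_derivMX (T : nzRingType) (p : {poly T}) i : (p^`() * 'X)`_i = p`_i *+ i.
Proof. by rewrite coefMX coef_deriv; case: i. Qed.

(** For degrees [a > b] the coefficient in degree [a + b - 1] is [a - b] times the product of the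
    leading coefficients, nonzero in characteristic zero. *)
Lemma size_wronskian (F : numFieldType) (p q : {poly F}) :
  q != 0 -> (size q < size p)%N ->
  (size p + size q <= (size (p^`() * q - p * q^`())%R).+2)%N.
Proof.
move=> q0 qp; set W := _ - _.
have p0 : p != 0 by rewrite -size_poly_gt0 (leq_ltn_trans _ qp).
have lp : lead_coef p != 0 by rewrite lead_coef_eq0.
have lq : lead_coef q != 0 by rewrite lead_coef_eq0.
rewrite !lead_coefE in lp lq.
rewrite -size_poly_gt0 in q0.
case sp: (size p) qp lp => [|a] // qp lp; case sq: (size q) q0 qp lq => [|b] // _.
rewrite ltnS => ba lq.
(* Multiplying by ['X] also covers a constant [q], where [q^`() = 0]. *)
have sX (r : {poly F}) c : size r = c.+1 -> (size (r^`() * 'X)%R <= c.+1)%N.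
  move=> sr; apply/leq_sizeP => j cj.
  by rewrite coef_derivMX nth_default ?mul0rn // sr.
have WE : W * 'X = (p^`() * 'X) * q - p * (q^`() * 'X).
  by rewrite /W mulrBl -!mulrA (mulrC q).
have WX : (W * 'X)`_(a + b) != 0.
  rewrite WE coefB !coefM_top ?sX ?sp ?sq // !coef_derivMX mulrnAl mulrnAr.
  rewrite -mulrnBr; last exact: ltnW.
  by rewrite mulrn_eq0 subn_eq0 leqNgt ba /= mulf_neq0.
have W0 : W != 0 by apply: contraNneq WX => ->; rewrite mul0r coef0.
rewrite addSn addnS !ltnS -ltnS -(size_mulX W0) ltnNge.
by apply: contra WX => /leq_sizeP ->.
Qed.

(** * Lower bounds for the real part of [eta / d], and domination of [nu / d] by it *)

Section RealPart.
Variable R : realType.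
Local Notation C := R[i].
Local Notation Re := complex.Re.
Variables (e : R) (m : nat) (eta d : {poly C}).
Implicit Type nu : {poly C}.
Hypothesis e_gt0 : 0 < e.
Hypothesis d_neq0 : forall s : C, - e < Re s -> d.[s] != 0.
Hypothesis D_ge0 : forall s : C, - e < Re s -> 0 <= Re (eta.[s] / d.[s]).
Hypothesis pencil_lead : forall w : C, Re w <= 0 ->
  size (eta - w *: d) = m.+1 /\ 1 <= `|lead_coef (eta - w *: d)|.

Lemma pencil_neq0 w s : Re w < 0 -> - e < Re s -> (eta - w *: d).[s] != 0.
Proof.
move=> w0 es; apply/negP; rewrite hornerD hornerN hornerZ subr_eq0 => /eqP E.
by have := D_ge0 es; rewrite E mulfK ?d_neq0 // leNgt w0.
Qed.

Lemma pencil_norm w s : - e < Re s ->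
  `|(eta - w *: d).[s]| = `|d.[s]| * `|eta.[s] / d.[s] - w|.
Proof.
move=> es; rewrite -normrM mulrBr mulrCA mulfV ?d_neq0 // mulr1.
by rewrite hornerD hornerN hornerZ (mulrC w).
Qed.

Lemma Re_quotient_ge s : - e < Re s ->
  ((Re s + e) ^+ m)%:C <= `|d.[s]| * (Re (eta.[s] / d.[s]))%:C.
Proof.
move=> es; set D := _ / _.
pose v := Re `|d.[s]|.
have vE : `|d.[s]| = v%:C by rewrite /v RRe_real ?normr_real.
have v0 : 0 < v by rewrite -ltcR -vE normr_gt0 d_neq0.
rewrite vE -rmorphM /= lecR.
apply/ler_addgt0Pr => de de0.
(* This [w] lies just left of the imaginary axis, level with [D], so that [|D - w| = Re D + de / v];
   multiplied by [v] this is [v * Re D + de]. *)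
pose w := D - (Re D + de / v)%:C.
have Rw : Re w = - (de / v) by rewrite /w ReB /= opprD addrA subrr add0r.
have w0 : Re w < 0 by rewrite Rw oppr_lt0 divr_gt0.
have [sz ld] := pencil_lead (ltW w0).
have := halfplane_lead_le (fun z => @pencil_neq0 w z w0) es.
rewrite pencil_norm // sz opprK /= -/D vE => h.
have Dp : 0 <= Re D + de / v by rewrite addr_ge0 ?D_ge0 // divr_ge0 // ltW.
have -> : v * Re D + de = v * (Re D + de / v).
  by rewrite mulrDr mulrCA mulfV ?mulr1 // gt_eqF.
rewrite -lecR rmorphXn rmorphM /=.
apply: le_trans (le_trans _ h) _; first rewrite ler_peMl //.
  by rewrite exprn_ge0 // ler0c ltW // -ltrBlDr sub0r.
by rewrite /w opprB addrCA subrr addr0 ger0_norm // ler0c.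
Qed.

Lemma Re_quotient_gt0 s : - e < Re s -> 0 < Re (eta.[s] / d.[s]).
Proof.
move=> es; have := Re_quotient_ge es; rewrite lt_neqAle D_ge0 // andbT eq_sym.
apply: contraTneq => ->.
rewrite (rmorph0 (real_complex R)) mulr0 lt_geF // ltcR exprn_gt0 //.
by rewrite -ltrBlDr sub0r.
Qed.

(* The bound on the logarithmic derivative of [eta - w *: d] at [w = - D^*], for which
   [eta / d - w = 2 * Re D]. *)
Lemma Re_quotient_ge_wronskian s : - e < Re s ->
  (Re s + e)%:C * `|(eta^`() * d - eta * d^`()).[s]| <=
    (2 * (m + (size d).-1)%:R * Re (eta.[s] / d.[s]))%:C * `|d.[s]| ^+ 2.
Proof.
move=> es; set D := _ / _.
have D0 : 0 < Re D by exact: Re_quotient_gt0.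
pose w : C := - D^*%C.
have Rw : Re w = - Re D by rewrite /w; case: (D).
have w0 : Re w < 0 by rewrite Rw oppr_lt0.
have b0 : 0 <= (Re s + e)%:C :> C by rewrite ler0c ltW // -ltrBlDr sub0r.
have [sz _] := pencil_lead (ltW w0).
have DJ : D - w = (2 * Re D)%:C by rewrite /w opprK addcJ rmorphM rmorph_nat.
have normDJ : `|D - w| = (2 * Re D)%:C.
  by rewrite DJ ger0_norm // ler0c mulr_ge0 // ltW.
have hP := halfplane_deriv_le (fun z => @pencil_neq0 w z w0) es.
rewrite pencil_norm // sz opprK /= -/D normDJ in hP.
have hd := halfplane_deriv_le d_neq0 es; rewrite opprK in hd.
have -> : (eta^`() * d - eta * d^`()).[s] =
    d.[s] * ((eta - w *: d)^`().[s] - (D - w) * d^`().[s]).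
  rewrite derivB derivZ !hornerE /D.
  by field; exact: d_neq0.
rewrite normrM expr2 mulrCA [leRHS]mulrCA ler_wpM2l //.
apply: le_trans (ler_wpM2l b0 (ler_normB _ _)) _.
rewrite mulrDr normrM normDJ natrD.
have -> : (2 * (m%:R + (size d).-1%:R) * Re D)%:C * `|d.[s]| =
   m%:R * (`|d.[s]| * (2 * Re D)%:C) + (2 * Re D)%:C * ((size d).-1%:R * `|d.[s]|) :> C.
  by ring.
apply: lerD => //; rewrite mulrCA ler_wpM2l //.
by rewrite ler0c mulr_ge0 // ltW.
Qed.

(** Dividing by [|d.[s]|] gives [|Re (nu / d)| <= K * Re (eta / d)], hence the lower bound [- K] for
    the quotient in the theorem. The radius [M] lets the estimate be proved first near infinity. *)
Definition dominated_by_Re nu (M : R) := exists2 K : R, 0 <= K &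
  forall s, 0 < Re s -> M%:C <= `|s| ->
    `|nu.[s]| <= (K * Re (eta.[s] / d.[s]))%:C * `|d.[s]|.

(** For [|s| < M], [nu] is bounded by a constant [L], while [Re_quotient_ge] gives [e ^+ m <=
    |d.[s]| * Re (eta / d)]; this adds [Re L / e ^+ m] to the constant. *)
Lemma dominated_by_Re_extend nu M : dominated_by_Re nu M -> dominated_by_Re nu 0.
Proof.
move=> [K K0 hK].
pose L : C := (\sum_(i < size nu) `|nu`_i|) * (1 + `|M|)%:C ^+ size nu.
have M1 : 1 <= (1 + `|M|)%:C :> C by rewrite -[1]/(1%:C) lecR lerDl.
have L0 : 0 <= L by rewrite mulr_ge0 ?sumr_ge0 // exprn_ge0 // (le_trans _ M1).
have LE : L = (Re L)%:C by rewrite RRe_real // ger0_real.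
have L0R : 0 <= Re L by rewrite -ler0c -LE.
have em0 : 0 < e ^+ m by rewrite exprn_gt0.
exists (K + Re L / e ^+ m) => [|s s0 _]; first by rewrite addr_ge0 // divr_ge0 // ltW.
have es : - e < Re s by rewrite (lt_trans _ s0) // oppr_lt0.
have D0 := ltW (Re_quotient_gt0 es).
pose v := Re `|s|.
have vE : `|s| = v%:C by rewrite /v RRe_real ?normr_real.
have [Mv|vM] := leP M v.
  apply: le_trans (hK s s0 _) _; first by rewrite vE lecR.
  by rewrite ler_wpM2r // lecR ler_wpM2r // lerDl divr_ge0 // ltW.
have hs : `|nu.[s]| <= L.
  apply: horner_norm_le => //; rewrite vE lecR (le_trans (ltW vM)) //.
  by rewrite (le_trans (ler_norm M)) // lerDr.
apply: (le_trans hs).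
apply: le_trans (_ : (Re L / e ^+ m)%:C * (`|d.[s]| * (Re (eta.[s] / d.[s]))%:C) <= _).
  apply: le_trans (ler_wpM2l _ (Re_quotient_ge es)); last by rewrite ler0c divr_ge0 // ltW.
  rewrite LE -rmorphM /= lecR -mulrA ler_peMr // mulrC ler_pdivlMr // mul1r.
  by rewrite lerXn2r ?nnegrE ?addr_ge0 ?lerDr // ltW.
rewrite mulrA mulrAC -rmorphM /= ler_wpM2r // lecR ler_wpM2r // lerDr //.
Qed.

(** Here [eta / d] has a pole at infinity. The degree of [W] gives [|nu * d| <= c * |W|] for large
    [s]; the Wronskian bound, with [e <= Re s + e], then yields the claim after cancelling one
    factor [|d|]. *)
Lemma dominated_by_Re_improper nu : size eta = m.+1 -> d != 0 ->
  (size d <= m)%N -> (size nu <= m)%N -> dominated_by_Re nu 0.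
Proof.
move=> seta d0 sd snu.
set W := eta^`() * d - eta * d^`().
have sW : (m + size d <= (size W).+1)%N.
  by rewrite -ltnS -addSn -seta size_wronskian // seta ltnS.
have d_gt0 : (0 < size d)%N by rewrite size_poly_gt0.
have W0 : W != 0.
  rewrite -size_poly_gt0 -ltnS (leq_trans _ sW) // -(addn1 1) leq_add //.
  exact: leq_trans d_gt0 sd.
have snd : (size (nu * d)%R <= size W)%N.
  rewrite (leq_trans (size_polyMleq _ _)) // -ltnS (leq_trans _ sW) //.
  by rewrite prednK ?addn_gt0 ?d_gt0 ?orbT // leq_add2r.
have [M [c [c0 hM]]] := horner_dominated W0 snd.
apply: (@dominated_by_Re_extend _ M).
pose N : R := (m + (size d).-1)%:R.
exists (c * (2 * N) / e) => [|s s0 Ms]; first by rewrite !mulr_ge0 ?invr_ge0 // ltW.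
have es : - e < Re s by rewrite (lt_trans _ s0) // oppr_lt0.
have := Re_quotient_ge_wronskian es; rewrite -/W -/N.
set rD := Re (_ / _) => hW.
have e0c : 0 < e%:C :> C by rewrite ltcR.
have {}hW : e%:C * `|W.[s]| <= (2 * N * rD)%:C * `|d.[s]| ^+ 2.
  by apply: le_trans hW; rewrite ler_wpM2r // lecR lerDr ltW.
have dn0 : 0 < `|d.[s]| by rewrite normr_gt0 d_neq0.
have := hM s Ms; rewrite hornerM normrM => h.
rewrite -(ler_pM2r dn0) -(ler_pM2l e0c) (le_trans (ler_wpM2l (ltW e0c) h)) //.
rewrite mulrCA (le_trans (ler_wpM2l _ hW)) ?ler0c //.
rewrite le_eqVlt; apply/orP; left; apply/eqP.
have -> : c * (2 * N) / e * rD = e^-1 * (c * (2 * N * rD)) by ring.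
rewrite !(rmorphM (real_complex R)) (fmorphV (real_complex R)) expr2 /=.
by field; rewrite gt_eqF.
Qed.

Lemma dominated_by_Re_proper nu : size d = m.+1 ->
  (size (d - eta)%R <= m)%N -> (size nu <= m)%N -> dominated_by_Re nu 0.
Proof.
move=> sd spsi snu; set psi := d - eta in spsi.
have d0 : d != 0 by rewrite -size_poly_gt0 sd.
have [|M1 [c1 [c10 h1]]] := @horner_dominated _ d nu d0; first by rewrite sd leqW.
(* The extra factor ['X] turns [deg psi < deg d] into the decay [|psi / d| <= c2 / |s|] for large
   [s]. *)
have [|M2 [c2 [c20 h2]]] := @horner_dominated _ d (psi * 'X) d0.
  by rewrite sd (leq_trans (size_polyMleq _ _)) // size_polyX addn2.
(* This radius exceeds both thresholds and makes [c2 / |s|] at most [1 / 2], so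
   [Re (eta / d) >= 1 / 2]; hence the [2] in the constant [2 * c1]. *)
apply: (@dominated_by_Re_extend _ (`|M1| + `|M2| + (2 * c2 + 1))).
have c2p : 0 < 2 * c2 + 1 by rewrite ltr_wpDl // mulr_ge0.
exists (2 * c1) => [|s s0]; first by rewrite mulr_ge0.
have es : - e < Re s by rewrite (lt_trans _ s0) // oppr_lt0.
pose v := Re `|s|.
have vE : `|s| = v%:C by rewrite /v RRe_real ?normr_real.
rewrite vE lecR => Ms.
have [n1 n2] := (ler_norm M1, ler_norm M2).
have [p1 p2] := (normr_ge0 M1, normr_ge0 M2).
have {h1} := h1 s; rewrite vE lecR => /(_ ltac:(lra)) h1.
have {h2} := h2 s; rewrite vE lecR hornerM hornerX normrM vE => /(_ ltac:(lra)) h2.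
have dn0 : 0 < `|d.[s]| by rewrite normr_gt0 d_neq0.
have hpsi : `|psi.[s] / d.[s]| <= (2^-1)%:C.
  rewrite normrM normfV ler_pdivrMr // -(ler_pM2l (_ : 0 < (2 * c2 + 1)%:C)); last first.
    by rewrite ltcR.
  rewrite mulrA; apply: le_trans (_ : v%:C * `|psi.[s]| <= _).
    by rewrite ler_wpM2r // lecR; lra.
  rewrite mulrC (le_trans h2) // ler_wpM2r // -rmorphM /= lecR.
  by lra.
have hD : eta.[s] / d.[s] = 1 - psi.[s] / d.[s].
  by rewrite /psi hornerD hornerN mulrBl mulfV ?d_neq0 // opprB addrCA subrr addr0.
have D2 : 1 <= 2 * Re (eta.[s] / d.[s]).
  have := le_trans (Re_le_norm _) hpsi; rewrite lecR hD ReB /=.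
  by lra.
apply: (le_trans h1); rewrite ler_wpM2r // lecR mulrAC mulrC ler_peMr //.
Qed.

End RealPart.

(** * Evaluation of fractions and transfer of strict positive realness *)

Section RationalEvaluation.
Variable R : realType.
Local Notation C := R[i].
Local Notation Re := complex.Re.
Implicit Types (p q n d : {poly C}) (s z : C).

(** Cross-multiplying with the reduced fraction shows that cancellation cannot remove a zero of [q]
    at which [p] does not vanish. *)
Lemma rat_frac_analytic p q s : q != 0 -> (q.[s] = 0 -> p.[s] != 0) ->
  rat_analytic_at (p%:F / q%:F) s -> q.[s] != 0.
Proof.
move=> q0 pq; have [d0 _ fE] := rat_num_den (p%:F / q%:F).
set f := _ / _ in d0 fE *; rewrite /rat_analytic_at => ds.
have E : p * rat_den f = rat_num f * q.
  apply/eqP; rewrite -tofrac_eq !tofracM -eqr_div ?tofrac_eq0 //.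
  by apply/eqP.
apply/negP => /eqP qs; have := congr1 (fun P : {poly C} => P.[s]) E.
rewrite !hornerM qs mulr0 => /eqP; rewrite mulf_eq0 (negPf ds) orbF.
by apply/negP/pq.
Qed.

Lemma coprimep_horner p q s : coprimep p q -> q.[s] = 0 -> p.[s] != 0.
Proof.
move=> cop q0; apply/negP => /eqP p0; have [[u v] /= uv] := Bezout_eq1_coprimepP _ _ cop.
have := congr1 (fun P : {poly C} => P.[s]) uv.
rewrite !hornerE p0 q0 !mulr0 addr0 => /eqP.
by rewrite eq_sym oner_eq0.
Qed.

(** The shift at [s + e] is the original at [s]. It is built from the reduced fraction, whose two
    parts have no common zero, so analyticity transfers back and then excludes [d.[s] = 0]. *)
Lemma strictly_positive_real_halfplane n d : d != 0 ->
    (forall s, d.[s] = 0 -> n.[s] != 0) ->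
  strictly_positive_real (n%:F / d%:F) ->
  exists2 e : R, 0 < e &
    forall s, - e < Re s -> d.[s] != 0 /\ 0 <= Re (n.[s] / d.[s]).
Proof.
move=> d0 nd [e e0 [_ hpos]]; exists e => // s es.
set f := _ / _ in hpos.
have [fd0 cop _] := rat_num_den f.
have sE (q : {poly C}) : (q \Po ('X - (e%:C)%:P)).[s + e%:C] = q.[s].
  by rewrite horner_comp !hornerE addrK.
have ann : rat_analytic_at f s.
  have [|an _] := hpos (s + e%:C); first by rewrite /rhp /= ReD /= -ltrBlDr sub0r.
  rewrite /rat_analytic_at -sE; move: an; apply: rat_frac_analytic.
    by rewrite comp_poly2_eq0 ?size_XsubC.
  by rewrite !sE; exact: coprimep_horner.
have ds : d.[s] != 0 by apply: rat_frac_analytic ann => //; exact: nd.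
split=> //; have [|_] := hpos (s + e%:C); first by rewrite /rhp /= ReD /= -ltrBlDr sub0r.
have [|_ ->] := @rat_shiftE _ f e (s + e%:C); first by rewrite addrK.
by rewrite addrK; have [_ ->] := @rat_fracE _ n d s ds.
Qed.

Lemma Re_inv_ge0 z : (0 <= Re z^-1) = (0 <= Re z).
Proof.
suff {z} H z : 0 <= Re z -> 0 <= Re z^-1.
  by apply/idP/idP => /H //; rewrite invrK.
by case: z => a b /= a0; rewrite divr_ge0 // addr_ge0 // sqr_ge0.
Qed.

Lemma conj_poly_real p : map_poly (@conjc R) p = p ->
  exists q : {poly R}, p = map_poly (real_complex R) q.
Proof.
move=> pJ; exists (map_poly (@complex.Re R) p); apply/polyP => i.
rewrite coef_map /= coef_map_id0 // RRe_real //.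
have := congr1 (fun q : {poly C} => q`_i) pJ; rewrite coef_map /=.
case: p`_i => a b [] /eqP; rewrite complex_real eq_sym -subr_eq0 opprK.
by rewrite -mulr2n mulrn_eq0.
Qed.

End RationalEvaluation.

(** * Node polynomials, their values at the nodes, and their symmetry under conjugation *)

Section Interpolation.
Variables (R : realType) (m : nat) (x : 'I_m -> R[i]).
Hypothesis x_inj : injective x.
Local Notation C := R[i].
Local Notation Re := complex.Re.
Local Notation Im := complex.Im.
Local Notation eta := Defs.eta.
Implicit Types g : 'I_m -> C.

Lemma eta_phi j : eta x = ('X - (x j)%:P) * phi x j.
Proof. by rewrite /eta (bigD1 j). Qed.

Lemma size_eta : size (eta x) = m.+1.
Proof. by rewrite size_prod_XsubC /index_enum -enumT size_enum_ord. Qed.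

Lemma lead_coef_eta : lead_coef (eta x) = 1.
Proof. exact/monicP/monic_prod_XsubC. Qed.

Lemma size_phi j : size (phi x j) = m.
Proof.
have := size_eta; rewrite (eta_phi j) size_monicM ?monicXsubC //.
  by rewrite size_XsubC add2n /= => -[].
by apply: contra_eq_neq size_eta => p0; rewrite (eta_phi j) p0 mulr0 size_poly0.
Qed.

Lemma eta_root s : (eta x).[s] = 0 -> exists j, s = x j.
Proof.
rewrite /eta horner_prod => /eqP; rewrite prodf_seq_eq0 => /hasP[j _ /=].
by rewrite hornerXsubC subr_eq0 => /eqP; exists j.
Qed.

Lemma phi_neq0 j : (phi x j).[x j] != 0.
Proof.
rewrite /phi horner_prod; apply/prodf_neq0 => k kj.
by rewrite hornerXsubC subr_eq0 (inj_eq x_inj) eq_sym.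
Qed.

Lemma eta_node j : (eta x).[x j] = 0.
Proof. by rewrite (eta_phi j) hornerM hornerXsubC subrr mul0r. Qed.

Lemma sum_phi_node g j :
  (\sum_(k < m) g k *: phi x k).[x j] = g j * (phi x j).[x j].
Proof.
rewrite horner_sum (bigD1 j) //= hornerZ big1 ?addr0 // => k kj.
rewrite hornerZ /phi horner_prod (bigD1 j) 1?eq_sym //=.
by rewrite hornerXsubC subrr mul0r mulr0.
Qed.

Lemma size_sum_phi g : (size (\sum_(k < m) g k *: phi x k)%R <= m)%N.
Proof.
apply: (leq_trans (size_sum _ _ _)); apply/bigmax_leqP => k _.
by rewrite (leq_trans (size_scale_leq _ _)) ?size_phi.
Qed.

Section Conjugation.
Variable sigma : 'I_m -> 'I_m.
Hypothesis x_sigma : forall j, x (sigma j) = (x j)^*%C.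

Lemma sigmaK : involutive sigma.
Proof. by move=> j; apply: x_inj; rewrite !x_sigma conjcK. Qed.

Lemma eta_conj : map_poly (@conjc R) (eta x) = eta x.
Proof.
rewrite /eta rmorph_prod /= [RHS](reindex_inj (inv_inj sigmaK)) /=.
by apply: eq_bigr => j _; rewrite rmorphB /= map_polyX map_polyC /= x_sigma.
Qed.

Lemma phi_conj j : map_poly (@conjc R) (phi x j) = phi x (sigma j).
Proof.
rewrite /phi rmorph_prod /= [RHS](reindex_inj (inv_inj sigmaK)) /=.
apply: eq_big => k; first by rewrite (inj_eq (inv_inj sigmaK)).
by move=> _; rewrite rmorphB /= map_polyX map_polyC /= x_sigma.
Qed.

Lemma sum_phi_conj g : (forall j, g (sigma j) = (g j)^*%C) ->
  map_poly (@conjc R) (\sum_(k < m) g k *: phi x k) = \sum_(k < m) g k *: phi x k.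
Proof.
move=> gJ; rewrite rmorph_sum [RHS](reindex_inj (inv_inj sigmaK)) /=.
by apply: eq_bigr => k _; rewrite map_polyZ phi_conj /= gJ.
Qed.

End Conjugation.

(** Turns the adjacency of conjugate pairs into one index map serving nodes, values and all
    compatible coefficients; conjugating the polynomials then only permutes factors and summands. *)
Lemma conj_closed_involution y : conj_closed x y -> exists sigma : 'I_m -> 'I_m,
  [/\ forall j, x (sigma j) = (x j)^*%C, forall j, y (sigma j) = (y j)^*%C
    & forall g, conj_compatible x g -> forall j, g (sigma j) = (g j)^*%C].
Proof.
move=> [hpos hnreal hreal].
have conjc_fix (z : C) : Im z = 0 -> z = z^*%C by case: z => a b /= ->; rewrite oppr0.
suff /choice[sigma hs] : forall j, exists j', [/\ x j' = (x j)^*%C,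
    y j' = (y j)^*%C & forall g, conj_compatible x g -> g j' = (g j)^*%C].
  by exists sigma; split=> [j|j|g hg j]; have [] := hs j => // _ _; exact.
move=> j; have [Ij|Ij] := eqVneq (Im (x j)) 0.
  exists j; split; [exact: conjc_fix|exact/conjc_fix/hreal|].
  by move=> g [gr _]; exact/conjc_fix/gr.
have [i Ii [->|ji]] := hnreal j Ij; have [i' ii' [xi' yi']] := hpos i Ii.
  by exists i'; split=> // g [_]; exact.
have -> : j = i' by apply: val_inj; rewrite /= ji ii'.
exists i; split; rewrite ?xi' ?yi' ?conjcK //.
by move=> g [_ gc]; rewrite (gc i i') ?conjcK.
Qed.

Section Kind.
Variables (y gamma c : 'I_m -> C) (k : kind).
Hypothesis y_neq0 : forall j, y j != 0.
Hypothesis gamma_neq0 : forall j, gamma j != 0.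
Hypothesis c_neq0 : forall j, c j != 0.
Local Notation d := (d_poly x gamma c k).
Local Notation nu := (nu_hat x y gamma c k).

(** At a node only the matching [phi] survives. Since the roots of [eta] are nodes, [d] and [eta]
    have no common zero. *)
Lemma d_poly_node j : d.[x j] != 0.
Proof.
case: k => /=; rewrite ?hornerD ?eta_node ?add0r sum_phi_node mulf_neq0 //;
  exact: phi_neq0.
Qed.

Lemma nu_hat_node j : nu.[x j] != 0.
Proof.
by case: k => /=; rewrite sum_phi_node !mulf_neq0 ?invr_neq0 // phi_neq0.
Qed.

Lemma size_nu_hat : (size nu <= m)%N.
Proof. by case: k => /=; exact: size_sum_phi. Qed.

(** The leading coefficient is [1] for [kind_o], where [d] has degree below [m], and [1 - w] for
    [kind_1], with real part at least [1]. *)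
Lemma pencil_lead_coef (w : C) : Re w <= 0 ->
  size (eta x - w *: d) = m.+1 /\ 1 <= `|lead_coef (eta x - w *: d)|.
Proof.
move=> w0.
have [a [g [Ra ->]]] : exists a g, 1 <= Re a /\
    eta x - w *: d = a *: eta x + \sum_(j < m) g j *: phi x j.
  case: k => /=.
    exists 1, (fun j => - w * gamma j); split=> //.
    rewrite scale1r -scaleNr scaler_sumr; congr (_ + _).
    by apply: eq_bigr => j _; rewrite scalerA.
  exists (1 - w), (fun j => - w * c j); split; first by rewrite ReB /= lerDl oppr_ge0.
  rewrite scalerBl scale1r scalerDr opprD addrA; congr (_ + _).
  by rewrite -scaleNr scaler_sumr; apply: eq_bigr => j _; rewrite scalerA.
have a1 : 1 <= `|a| by apply: le_trans (Re_le_norm a); rewrite -[1]/(1%:C) lecR.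
have a0 : a != 0 by rewrite -normr_gt0 (lt_le_trans ltr01).
have sz : (size (\sum_(j < m) g j *: phi x j)%R < size (a *: eta x)%R)%N.
  by rewrite size_scale // size_eta ltnS size_sum_phi.
rewrite size_polyDl // size_scale // size_eta; split=> //.
by rewrite lead_coefDl // lead_coefZ lead_coef_eta mulr1.
Qed.

End Kind.
End Interpolation.

(** * Reciprocals with nonnegative real part, and the smallest parameter *)

Section ReciprocalOnHalfPlane.
Variable R : realType.
Local Notation C := R[i].
Local Notation Re := complex.Re.
Implicit Types n d : {poly C}.

(** As [d] has no zero in the half plane, the poles of [d / n] there are the zeros of [n]. The point
    [t] shows that [n] is not identically zero, so [posreal_zero_eq0] excludes such zeros. *)
Lemma rhp_nonneg_Re_inv n d t : n.[t] != 0 -> (forall s, 0 < Re s -> d.[s] != 0) ->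
  rhp_nonneg_Re (d%:F / n%:F) <-> forall s, 0 < Re s -> 0 <= Re (n.[s] / d.[s]).
Proof.
move=> nt dN0; have n0 : n != 0 by apply: contraNneq nt => ->; rewrite horner0.
split=> H s s0.
  have [an] := H s s0.
  have ns : n.[s] != 0 by apply: rat_frac_analytic an => // _; exact: dN0.
  by have [_ ->] := @rat_fracE _ d n s ns; rewrite -Re_inv_ge0 invf_div.
have ns : n.[s] != 0.
  by apply: contraNneq nt => ns; rewrite (posreal_zero_eq0 t dN0 H s0 ns).
by have [an ->] := @rat_fracE _ d n s ns; rewrite -Re_inv_ge0 invf_div; split=> //; exact: H.
Qed.

End ReciprocalOnHalfPlane.

Lemma f_hatE (R : realType) (m : nat) (x y gamma c : 'I_m -> R[i]) k (r : R) :
  d_poly x gamma c k != 0 -> f_hat x y gamma c k r =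
    (d_poly x gamma c k)%:F / (nu_hat x y gamma c k + r%:C *: Defs.eta x)%:F.
Proof.
move=> d0; rewrite /f_hat /p_hat /Delta mulrA -tofracM mul_polyC -mulrDl -tofracD.
by rewrite invf_div.
Qed.

Theorem proposition2p16 (R : realType) (m : nat) (x y gamma c : 'I_m -> R[i])
  (m_gt0 : (0 < m)%N)
  (x_inj : injective x)
  (x_lhp : forall j, complex.Re (x j) < 0)
  (y_neq0 : forall j, y j != 0)
  (xy_conj : conj_closed x y)
  (gamma_neq0 : forall j, gamma j != 0)
  (c_neq0 : forall j, c j != 0)
  (gamma_conj : conj_compatible x gamma)
  (c_conj : conj_compatible x c)
  (Delta_spr : forall k : kind, strictly_positive_real (Delta x gamma c k)) :
  forall k : kind, exists rmin : R,
    let S := [set r : R | rhp_nonneg_Re (f_hat x y gamma c k r)] in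
    [/\ S rmin /\ lbound S rmin,
        (rmin%:E = - ereal_inf
           [set (complex.Re (rat_eval (p_hat x y gamma c k) s) /
                 complex.Re (rat_eval (Delta x gamma c k) s))%:E | s in @rhp R])%E
      & forall r : R, positive_real (f_hat x y gamma c k r) <-> rmin <= r].
Proof.
move=> k.
pose d := d_poly x gamma c k; pose nu := nu_hat x y gamma c k.
pose et := Defs.eta x; pose j0 := Ordinal m_gt0.
have dj j : d.[x j] != 0 by exact: d_poly_node.
have d0 : d != 0 by apply: contraNneq (dj j0) => ->; rewrite horner0.
have [|e e0 he] := strictly_positive_real_halfplane d0 _ (Delta_spr k).
  by move=> s ds; apply/negP => /eqP/eta_root[j sj]; have := dj j; rewrite -sj ds eqxx.
have dN0 (s : R[i]) : - e < complex.Re s -> d.[s] != 0 by case/he.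
have D_ge0 (s : R[i]) : - e < complex.Re s -> 0 <= complex.Re (et.[s] / d.[s]) by case/he.
have hp (s : R[i]) : 0 < complex.Re s -> - e < complex.Re s.
  by apply: lt_trans; rewrite oppr_lt0.
have hL := pencil_lead_coef x gamma c k.
have D_gt0 (s : R[i]) : 0 < complex.Re s -> 0 < complex.Re (et.[s] / d.[s]).
  by move=> /hp es; exact: (Re_quotient_gt0 dN0 D_ge0 hL es).
have snu : (size nu <= m)%N by exact: size_nu_hat.
have [K K0 hK] : dominated_by_Re et d nu 0.
  (* For [kind_o] it is [d] that has degree below that of [eta], for [kind_1] it is [d - eta]; hence
     two growth arguments. *)
  move: dN0 D_ge0 hL snu d0; rewrite /d /nu /et; case: (k) => dN0 D_ge0 hL snu d0.
    apply: dominated_by_Re_improper e0 dN0 D_ge0 hL _ _ d0 _ snu; first exact: size_eta.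
    exact: size_sum_phi.
  apply: dominated_by_Re_proper e0 dN0 D_ge0 hL _ _ _ snu => /=.
    by rewrite size_polyDl size_eta // ltnS size_sum_phi.
  by rewrite addrC addKr size_sum_phi.
(* The condition reads [Re p + r * Re D >= 0], and [Re D > 0] allows dividing by it. *)
have SE r : rhp_nonneg_Re (f_hat x y gamma c k r) <->
    forall s, 0 < complex.Re s ->
      - r <= complex.Re (nu.[s] / d.[s]) / complex.Re (et.[s] / d.[s]).
  rewrite f_hatE //.
  (* [eta] vanishes at the node, so this value is nonzero for every [r]. *)
  have nj : (nu + r%:C *: et).[x j0] != 0.
    by rewrite hornerD hornerZ eta_node mulr0 addr0 nu_hat_node.
  apply: iff_trans (rhp_nonneg_Re_inv nj (fun s s0 => dN0 s (hp s s0))) _.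
  have E s : 0 < complex.Re s -> (0 <= complex.Re ((nu + r%:C *: et).[s] / d.[s])) =
      (- r <= complex.Re (nu.[s] / d.[s]) / complex.Re (et.[s] / d.[s])).
    move=> s0; rewrite hornerD hornerZ mulrDl -mulrA ReD Re_scale.
    by rewrite ler_pdivlMr ?D_gt0 // mulNr -[RHS]subr_ge0 opprK.
  by split=> H s s0; have := H s s0; rewrite E.
pose A := [set complex.Re (nu.[s] / d.[s]) / complex.Re (et.[s] / d.[s]) | s in @rhp R].
have A0 : A !=set0 by apply: image_nonempty; exists 1; exact: ltr01.
have Alb : lbound A (- K).
  move=> _ [s s0 <-]; rewrite ler_pdivlMr ?D_gt0 // mulNr lerNl -ReN -lecR.
  apply: le_trans (Re_le_norm _) _; rewrite normrN normrM normfV.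
  by rewrite ler_pdivrMr; [exact: hK (normr_ge0 s)|rewrite normr_gt0 dN0 ?hp].
have hA : has_inf A by split=> //; exists (- K).
have SA r : rhp_nonneg_Re (f_hat x y gamma c k r) <-> - inf A <= r.
  rewrite SE; split=> [H|H s s0].
    by rewrite lerNl; apply: lb_le_inf => // _ [s s0 <-]; exact: H.
  apply: (@le_trans _ _ (inf A)); first by rewrite lerNl.
  by apply: ge_inf; [exact: hA.2|exists s].
have real_f r : rat_real_coefs (f_hat x y gamma c k r).
  have [sigma [xs ys gs]] := conj_closed_involution xy_conj.
  have etJ := eta_conj x_inj xs.
  have dJ : map_poly (@conjc R) d = d.
    rewrite /d; case: (k) => /=; first exact: sum_phi_conj (gs _ gamma_conj).
    by rewrite rmorphD /= etJ (sum_phi_conj _ _ (gs _ c_conj)).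
  have nuJ : map_poly (@conjc R) nu = nu.
    by rewrite /nu; case: (k) => /=; apply: sum_phi_conj => // j;
      rewrite ys rmorphM fmorphV (gs _ gamma_conj, gs _ c_conj).
  have [p dE] := conj_poly_real dJ.
  have [q nE] : exists q, nu + r%:C *: et = map_poly (real_complex R) q.
    by apply: conj_poly_real; rewrite rmorphD /= map_polyZ nuJ etJ /= oppr0.
  exists p, q; rewrite -dE -nE f_hatE //; split=> //.
  have: (nu + r%:C *: et).[x j0] != 0.
    by rewrite hornerD hornerZ eta_node mulr0 addr0 nu_hat_node.
  by apply: contraNneq => q0; rewrite nE q0 rmorph0 horner0.
exists (- inf A) => S; split=> [||r].
- by split=> [|r /SA //]; rewrite /S /= SA.
(* [A] is nonempty and bounded below, so its extended infimum is the real one; as [d] has no zero on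
   the half plane, the rational evaluations are plain quotients. *)
- rewrite EFinN -ereal_inf_EFin //; last exact: hA.2.
  congr (- ereal_inf _)%E; rewrite /A image_comp; apply: eq_imagel => s s0 /=.
  have ds := dN0 s (hp s s0).
  by have [_ ->] := @rat_fracE _ nu d s ds; have [_ ->] := @rat_fracE _ et d s ds.
- by split=> [[_ /SA]|/SA].
Qed.
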